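(* Let $\mathcal{X}$ be a class of graphs. Then $\mathcal{X}$ has structurally bounded degree if and only if $\mathcal{X}$ is a function of a proper subclass of equivalence graphs.
   Context: All graphs are finite and simple; a class of graphs is a set of graphs closed under isomorphism; it is hereditary if closed under taking induced subgraphs. An equivalence graph is a graph each of whose connected components is a complete graph. A proper subclass of equivalence graphs is a hereditary class strictly contained in the class of all equivalence graphs. A class is of structurally bounded degree if it is a first-order transduction of a class of graphs of bounded maximum degree, where a class $\mathcal{Y}$ is a first-order transduction of a class $\mathcal{X}$ if there are constants $c,m$ and a first-order formula $\phi(x,y)$ such that every graph in $\mathcal{Y}$ is obtained from some $G\in\mathcal{X}$ by taking $c$ disjoint copies of $G$, coloring the vertices with $m$ colors (unary predicates), defining a new adjacency relation by $\phi$, and taking an induced subgraph. For a graph $G$ and distinct vertices $u,w$, $G(u,w)=1$ if they are adjacent and $0$ otherwise. If $G,H_1,\dots,H_k$ are graphs on the same vertex set $V$, $G$ is a (boolean) function of $H_1,\dots,H_k$ if there is a boolean function $f:\{0,1\}^k\to\{0,1\}$ with $G(a,b)=f(H_1(a,b),\dots,H_k(a,b))$ for all distinct $a,b\in V$. A class $\mathcal{Y}$ is a $k$-function of $\mathcal{X}$ if every $G\in\mathcal{Y}$ is a function of at most $k$ graphs from $\mathcal{X}$ (on the vertex set of $G$); $\mathcal{Y}$ is a function of $\mathcal{X}$ if it is a $k$-function for some $k\in\mathbb{N}$. *)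

(* Defs.v *)
From HB Require Import structures.
From mathcomp Require Import all_boot.

Set Implicit Arguments.
Unset Strict Implicit.
Unset Printing Implicit Defensive.

Record graph (V : finType) := Graph {
  adj :> rel V;
  adj_sym : symmetric adj;
  adj_irr : irreflexive adj }.

Definition isomorphic (V W : finType) (G : graph V) (H : graph W) : Prop :=
  exists2 f : V -> W, bijective f & forall x y, H (f x) (f y) = G x y.

Section Induced.
Variables (V : finType) (G : graph V) (A : {set V}).

Definition induced_adj : rel {x : V | x \in A} := fun x y => G (val x) (val y).

Lemma induced_sym : symmetric induced_adj.
Proof. by move=> x y; apply: adj_sym. Qed.

Lemma induced_irr : irreflexive induced_adj.
Proof. by move=> x; apply: adj_irr. Qed.

Definition induced : graph {x : V | x \in A} := Graph induced_sym induced_irr.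
End Induced.

Record graph_class := GraphClass {
  in_class :> forall V : finType, graph V -> Prop;
  class_iso : forall (V W : finType) (G : graph V) (H : graph W),
    isomorphic G H -> in_class G -> in_class H }.

Definition hereditary (X : graph_class) : Prop :=
  forall (V : finType) (G : graph V) (A : {set V}), X V G -> X _ (induced G A).

(* [connect G u v]: u and v lie in the same connected component of G. *)
Definition equivalence_graph (V : finType) (G : graph V) : Prop :=
  forall u v : V, connect G u v -> u != v -> G u v.

Definition proper_subclass_of_equivalence_graphs (X : graph_class) : Prop :=
  [/\ hereditary X,
      forall (V : finType) (G : graph V), X V G -> equivalence_graph G
    & exists (V : finType) (G : graph V), equivalence_graph G /\ ~ X V G].

Definition bounded_degree (X : graph_class) : Prop :=
  exists d : nat, forall (V : finType) (G : graph V), X V G ->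
    forall u : V, #|[set v | G u v]| <= d.

(* First-order formulas over one binary adjacency symbol, equality and m unary
   predicates. Variables are well-scoped de Bruijn indices: a formula of type
   [formula m n] has its free variables among the n variables of 'I_n, and a
   quantifier binds index 0, shifting the others up by one. *)
Inductive formula (m : nat) : nat -> Type :=
| FEq n of 'I_n & 'I_n : formula m n
| FAdj n of 'I_n & 'I_n : formula m n
| FCol n of 'I_m & 'I_n : formula m n
| FNot n of formula m n : formula m n
| FAnd n of formula m n & formula m n : formula m n
| FOr n of formula m n & formula m n : formula m n
| FExists n of formula m n.+1 : formula m n
| FForall n of formula m n.+1 : formula m n.

Fixpoint sat (V : finType) (G : graph V) (m : nat) (col : 'I_m -> {set V})
    (n : nat) (phi : formula m n) : n.-tuple V -> bool :=
  match phi in formula _ n return n.-tuple V -> bool with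
  | FEq _ i j => fun env => tnth env i == tnth env j
  | FAdj _ i j => fun env => G (tnth env i) (tnth env j)
  | FCol _ k i => fun env => tnth env i \in col k
  | FNot _ p => fun env => ~~ sat G col p env
  | FAnd _ p q => fun env => sat G col p env && sat G col q env
  | FOr _ p q => fun env => sat G col p env || sat G col q env
  | FExists _ p => fun env => [exists x, sat G col p (cons_tuple x env)]
  | FForall _ p => fun env => [forall x, sat G col p (cons_tuple x env)]
  end.

Section Copies.
Variables (V : finType) (G : graph V) (c : nat).

Definition copies_adj : rel ('I_c * V)%type :=
  fun x y => (x.1 == y.1) && G x.2 y.2.

Lemma copies_sym : symmetric copies_adj.
Proof. by move=> x y; rewrite /copies_adj eq_sym adj_sym. Qed.

Lemma copies_irr : irreflexive copies_adj.
Proof. by move=> x; rewrite /copies_adj adj_irr andbF. Qed.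

Definition copies : graph ('I_c * V)%type := Graph copies_sym copies_irr.
End Copies.

(* K is the graph defined by phi on the coloured disjoint union of c copies of
   G; since K is a [graph], phi is required to define a symmetric and
   irreflexive relation there. *)
Definition transduction_of (Y X : graph_class) : Prop :=
  exists (c m : nat) (phi : formula m 2),
    forall (W : finType) (H : graph W), Y W H ->
      exists (V : finType) (G : graph V) (col : 'I_m -> {set 'I_c * V})
             (K : graph ('I_c * V)%type) (A : {set 'I_c * V}),
        [/\ X V G,
            forall u v, K u v = sat (copies G c) col phi [tuple u; v]
          & isomorphic (induced K A) H].

Definition structurally_bounded_degree (X : graph_class) : Prop :=
  exists2 Y : graph_class, bounded_degree Y & transduction_of X Y.

Definition boolean_function_of (V : finType) (G : graph V) (k : nat)
    (H : 'I_k -> graph V) : Prop :=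
  exists f : k.-tuple bool -> bool,
    forall a b : V, a != b -> G a b = f [tuple H i a b | i < k].

Definition k_function_of (k : nat) (Y X : graph_class) : Prop :=
  forall (V : finType) (G : graph V), Y V G ->
    exists (j : nat) (H : 'I_j -> graph V),
      [/\ j <= k, forall i, X V (H i) & boolean_function_of G H].

Definition function_of (Y X : graph_class) : Prop :=
  exists k : nat, k_function_of k Y X.

(* Main.v *)
Require Import Defs.
From mathcomp Require Import all_boot.

Set Implicit Arguments.
Unset Strict Implicit.
Unset Printing Implicit Defensive.

(* From left to right: the edges of a graph of degree at most d split into
   boundedly many matchings, i.e. involutions, and two tuples are called
   R-similar if words of length at most R in these involutions satisfy the same
   equations and meet the same colours at both. Inside one finite structure a
   counting argument extends 3R-similar tuples to R-similar ones, so a formula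
   only depends on the similarity type of its arguments for a suitable radius;
   for two arguments that are far apart this is the pair of their local types.
   Hence the transduced graph is a function of the pair of types, up to a
   relation of bounded degree, and both are functions of 2K_3-free equivalence
   graphs: cliques on unions of two types, and matchings.

   From right to left: if an equivalence graph on n vertices is missing, then
   every graph of the class has fewer than n components with at least n
   vertices. Membership in these is recorded by colours, membership in the
   small ones by a bounded-degree incidence graph. *)

(** * Matchings in graphs of bounded degree *)

Lemma equivalence_graphP (V : finType) (G : graph V) :
  equivalence_graph G <->
  forall x y z, G x y -> G y z -> x != z -> G x z.
Proof.
split=> [eqG x y z Gxy Gyz|trG u v /connectP[p]].
  by apply: eqG; apply: connect_trans (connect1 Gxy) (connect1 Gyz).
elim: p u => [|y p IHp] u /=; first by move=> _ ->; rewrite eqxx.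
case/andP=> Guy path_p v_last neq_uv.
have [<- //|neq_yv] := eqVneq y v.
by apply: trG Guy _ neq_uv; apply: IHp.
Qed.

(** Colour the vertices one by one: at most [k] of the [k.+1] colours occur on the neighbours of the
    current vertex, so one is free. *)
Lemma greedy_coloring (V : finType) (e : rel V) (k : nat) :
  symmetric e -> (forall u, #|[set v | e u v]| <= k) ->
  exists chi : V -> 'I_k.+1, forall u v, u != v -> e u v -> chi u != chi v.
Proof.
move=> e_sym deg_e.
suff [chi chiP] : exists chi : V -> 'I_k.+1,
    {in enum V &, forall u v, u != v -> e u v -> chi u != chi v}.
  by exists chi => u v; apply: chiP; rewrite mem_enum.
elim: (enum V) => [|x s [chi chiP]]; first by exists (fun=> ord0).
pose used := chi @: [set v | e x v].
have [c c_unused] : exists c, c \notin used.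
  apply/existsP; rewrite -negb_forall; apply/negP=> /forallP all_used.
  have: #|'I_k.+1| <= #|used| by apply/subset_leq_card/subsetP.
  by rewrite card_ord ltnNge (leq_trans (leq_imset_card _ _)).
have c_free v : e x v -> chi v != c.
  by move=> exv; apply: contraNneq c_unused => <-; apply: imset_f; rewrite inE.
exists [eta chi with x |-> c] => u v /=.
rewrite !inE; case: (eqVneq u x) => [->|_]; case: (eqVneq v x) => [->|_] /=.
- by rewrite eqxx.
- by move=> _ _ _ exv; rewrite eq_sym c_free.
- by move=> _ _ _; rewrite e_sym; apply: c_free.
- by apply: chiP.
Qed.

(* Vertices with a common neighbour receive distinct colours, so that the edges
   whose endpoints carry two prescribed colours form a matching. *)
Lemma matching_decomposition (V : finType) (G : graph V) (d : nat) :
  (forall u, #|[set v | G u v]| <= d) ->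
  exists p : 'I_(d * d).+1 * 'I_(d * d).+1 -> V -> V,
    (forall i, involutive (p i)) /\
    (forall u v, G u v = (u != v) && [exists i, p i u == v]).
Proof.
move=> degG.
pose e u v := [exists z, G z u && G z v].
have e_sym : symmetric e by move=> u v; apply: eq_existsb => z; rewrite andbC.
have deg_e u : #|[set v | e u v]| <= d * d.
  have sub : [set v | e u v] \subset \bigcup_(z in [set z | G u z]) [set v | G z v].
    apply/subsetP=> v; rewrite inE => /existsP[z /andP[Gzu Gzv]].
    by apply/bigcupP; exists z; rewrite inE // adj_sym.
  apply: leq_trans (subset_leq_card sub) _.
  have bigU : #|\bigcup_(z in [set z | G u z]) [set v | G z v]|
      <= \sum_(z in [set z | G u z]) d.
    apply: (big_ind2 (fun (A : {set V}) n => #|A| <= n)) => [|A a B b leA leB|z _].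
    - by rewrite cards0.
    - exact: leq_trans (leq_card_setU A B) (leq_add leA leB).
    - exact: degG.
  by apply: leq_trans bigU _; rewrite sum_nat_const leq_mul2r degG orbT.
have [chi chiP] := greedy_coloring e_sym deg_e.
have chi_inj u v w : G u v -> G u w -> chi v = chi w -> v = w.
  move=> Guv Guw eq_chi; apply/eqP; apply: contra_eqT eq_chi => neq_vw.
  by apply: chiP => //; apply/existsP; exists u; rewrite Guv.
pose M (i : 'I_(d * d).+1 * 'I_(d * d).+1) u v :=
  G u v && ((chi u == i.1) && (chi v == i.2) || (chi u == i.2) && (chi v == i.1)).
have M_sym i : symmetric (M i).
  by move=> u v; rewrite /M adj_sym orbC ![(chi v == _) && _]andbC.
have M_fun i u v w : M i u v -> M i u w -> v = w.
  case/andP=> Guv c1 /andP[Guw c2]; apply: chi_inj Guv Guw _.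
  by case/orP: c1 => /andP[/eqP u1 /eqP->]; case/orP: c2 => /andP[/eqP u2 /eqP->];
     congruence.
(* Unmatched vertices become fixed points, so that [p i] is total; hence the condition [u != v] in
   the statement. *)
pose p i u := odflt u [pick v | M i u v].
have pE i u v : M i u v -> p i u = v.
  move=> Muv; rewrite /p; case: pickP => [w Muw|/(_ v)]; last by rewrite Muv.
  exact: M_fun Muw Muv.
have p_cases i u : p i u = u \/ M i u (p i u).
  by rewrite /p; case: pickP => [w Muw|_]; [right|left].
exists p; split=> [i u|u v].
  have [eq_u|Mu] := p_cases i u; first by rewrite !eq_u.
  by apply: pE; rewrite M_sym.
apply/idP/andP=> [Guv|[neq_uv /existsP[i /eqP piu]]].
  split; first by apply: contraTneq Guv => ->; rewrite adj_irr.
  apply/existsP; exists (chi u, chi v); apply/eqP/pE.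
  by rewrite /M Guv !eqxx.
have [|/andP[]] := p_cases i u; rewrite piu // => eq_vu.
by rewrite eq_vu eqxx in neq_uv.
Qed.

(** * Locality of first-order formulas *)

Section Locality.
Variables (V D : finType) (p : D -> V -> V).
Hypothesis pK : forall i, involutive (p i).
Variables (m : nat) (col : 'I_m -> {set V}).

Definition act (w : seq D) (x : V) : V := foldr p x w.

Lemma act_cat w w' x : act (w ++ w') x = act w (act w' x).
Proof. exact: foldr_cat. Qed.

Lemma act_revK w : cancel (act w) (act (rev w)).
Proof.
elim: w => //= i w IHw x.
by rewrite rev_cons -cats1 act_cat /= pK IHw.
Qed.

Lemma eq_act w x y : (act w x == y) = (x == act (rev w) y).
Proof. by apply/eqP/eqP=> [<-|->]; rewrite ?act_revK // -{1}[w]revK act_revK. Qed.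

(** The empty word expresses equality of entries, words of length one express adjacency of distinct
    entries. An equation with words on both sides takes this form once one of them is moved across,
    reversed. *)
Definition similar (R n : nat) (u v : n.-tuple V) : Prop :=
  forall w, size w <= R ->
    (forall i j, (tnth u i == act w (tnth u j)) = (tnth v i == act w (tnth v j)))
    /\ (forall i k, (act w (tnth u i) \in col k) = (act w (tnth v i) \in col k)).

Lemma similar_sym R n (u v : n.-tuple V) : similar R u v -> similar R v u.
Proof. by move=> uv w /uv[eq_uv col_uv]; split=> *. Qed.

Lemma similar_le R R' n (u v : n.-tuple V) :
  R <= R' -> similar R' u v -> similar R u v.
Proof. by move=> leR uv w /leq_trans/(_ leR)/uv. Qed.

(** Stored as a finite function on words, so that the number of types depends only on [R], [D] and
    [m], not on [V]. *)
Definition local_type (R : nat) (x : V) :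
    {ffun R.-bseq D -> bool * {ffun 'I_m -> bool}} :=
  [ffun w : R.-bseq D => (x == act w x, [ffun k => act w x \in col k])].

Lemma local_typeP R x y :
  local_type R x = local_type R y <->
  forall w, size w <= R ->
    (x == act w x) = (y == act w y) /\
    (forall k, (act w x \in col k) = (act w y \in col k)).
Proof.
split=> [/ffunP eq_lt w szw|eq_xy].
  have := eq_lt (Bseq szw); rewrite !ffunE /= => -[-> /ffunP eq_col].
  by split=> // k; have := eq_col k; rewrite !ffunE.
apply/ffunP=> w; rewrite !ffunE; have [-> eq_col] := eq_xy w (size_bseq w).
by congr (_, _); apply/ffunP=> k; rewrite !ffunE.
Qed.

Definition near (R : nat) (x y : V) : bool :=
  [exists w : R.-bseq D, y == act w x].

Lemma nearP R x y :
  reflect (exists2 w, size w <= R & y = act w x) (near R x y).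
Proof.
apply: (iffP existsP) => [[w /eqP->]|[w szw ->]].
  by exists w => //; apply: size_bseq.
by exists (Bseq szw).
Qed.

Lemma near_sym R : symmetric (near R).
Proof.
suff near_sub x y : near R x y -> near R y x by move=> x y; apply/idP/idP; apply: near_sub.
move=> /nearP[w szw ->]; apply/nearP; exists (rev w); rewrite ?size_rev //.
by rewrite act_revK.
Qed.

Lemma near_degree R x : #|[set y | near R x y]| <= #|{: R.-bseq D}|.
Proof.
have sub : [set y | near R x y] \subset (fun w : R.-bseq D => act w x) @: setT.
  by apply/subsetP=> y; rewrite inE => /existsP[w /eqP->]; apply: imset_f.
by apply: leq_trans (subset_leq_card sub) _; rewrite (leq_trans (leq_imset_card _ _)) ?cardsT.
Qed.

Lemma similar_near R n (u v : n.-tuple V) i j w w' :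
  similar (3 * R) u v -> size w <= R -> size w' <= R ->
  (act w (tnth u i) == act w' (tnth u j)) = (act w (tnth v i) == act w' (tnth v j)).
Proof.
move=> uv szw szw'; rewrite !eq_act -!act_cat.
have [|-> //] := uv (rev w ++ w').
by rewrite size_cat size_rev mulSn leq_add // (leq_trans szw') // leq_pmull.
Qed.

(** The factor 3 comes from here: an equation at [act w x] with word [w'] becomes one at [x] with
    word [rev w ++ w' ++ w], of length at most [3 * R]. *)
Lemma similar_local_type R n (u v : n.-tuple V) i w :
  similar (3 * R) u v -> size w <= R ->
  local_type R (act w (tnth u i)) = local_type R (act w (tnth v i)).
Proof.
move=> uv szw; apply/local_typeP=> w' szw'; split=> [|k]; rewrite -?act_cat.
  rewrite !eq_act -!act_cat.
  have [|-> //] := uv (rev w ++ w' ++ w).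
  by rewrite !size_cat size_rev !mulSn mul0n addn0 !leq_add.
have [|_ -> //] := uv (w' ++ w).
by rewrite size_cat !mulSn addnA (leq_trans (leq_add szw' szw)) ?leq_addr.
Qed.

(** On either side, a far entry satisfies no equation of length at most [R] with the old ones, so
    only its local type matters. *)
Lemma similar_cons_far R n (u v : n.-tuple V) a b :
  similar R u v -> local_type R a = local_type R b ->
  (forall i, ~~ near R (tnth u i) a) -> (forall i, ~~ near R (tnth v i) b) ->
  similar R (cons_tuple a u) (cons_tuple b v).
Proof.
move=> uv /local_typeP ab far_a far_b w szw.
have [eq_ab col_ab] := ab w szw; have [eq_uv col_uv] := uv w szw.
have far (t : n.-tuple V) c : (forall i, ~~ near R (tnth t i) c) ->
    forall i, (c == act w (tnth t i)) = false /\ (tnth t i == act w c) = false.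
  move=> far_c i; have := far_c i => /nearP nonear.
  split; apply/eqP=> eq_c; apply: nonear; first by exists w.
  by exists (rev w); rewrite ?size_rev // eq_c act_revK.
split=> [i j|i k]; case: (unliftP ord0 i) => [i'|] ->; rewrite ?tnthS ?tnth0 //.
- case: (unliftP ord0 j) => [j'|] ->; rewrite ?tnthS ?tnth0 //.
  by rewrite (far u a far_a i').2 (far v b far_b i').2.
case: (unliftP ord0 j) => [j'|] ->; rewrite ?tnthS ?tnth0 //.
by rewrite (far u a far_a j').1 (far v b far_b j').1.
Qed.

Lemma similar_cons_near R n (u v : n.-tuple V) i0 w0 :
  similar (3 * R) u v -> size w0 <= R ->
  similar R (cons_tuple (act w0 (tnth u i0)) u) (cons_tuple (act w0 (tnth v i0)) v).
Proof.
move=> uv szw0 w szw.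
have [eq_uv col_uv] : _ := similar_le (leq_pmull R (isT : 0 < 3)) uv szw.
have /local_typeP/(_ w szw)[eq_ab col_ab] := similar_local_type i0 uv szw0.
split=> [i j|i k]; case: (unliftP ord0 i) => [i'|] ->; rewrite ?tnthS ?tnth0 //.
- case: (unliftP ord0 j) => [j'|] ->; rewrite ?tnthS ?tnth0 //.
  rewrite -!act_cat; have [|-> //] := uv (w ++ w0).
  by rewrite size_cat !mulSn addnA (leq_trans (leq_add szw szw0)) ?leq_addr.
case: (unliftP ord0 j) => [j'|] ->; rewrite ?tnthS ?tnth0 //.
exact: (similar_near _ _ uv szw0 szw).
Qed.

(* The ball around [u] and the ball around [v] contain equally many vertices of
   the local type of [a], hence if one such vertex lies outside the first ball,
   then one lies outside the second. *)
Lemma far_witness R n (u v : n.-tuple V) a :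
  similar (3 * R) u v -> (forall i, ~~ near R (tnth u i) a) ->
  exists2 b, local_type R b = local_type R a & forall i, ~~ near R (tnth v i) b.
Proof.
move=> uv far_a.
pose T := [set x | local_type R x == local_type R a].
pose ball (t : n.-tuple V) := [set x | [exists i, near R (tnth t i) x]].
(* [F] carries [act w (tnth v i)] to [act w (tnth u i)], injectively by similarity; its value
   outside the ball is a dummy. *)
pose F x := if [pick iw : 'I_n * R.-bseq D | x == act iw.2 (tnth v iw.1)] is Some iw
            then act iw.2 (tnth u iw.1) else x.
have FP x : x \in ball v -> exists i w,
    [/\ size w <= R, x = act w (tnth v i) & F x = act w (tnth u i)].
  rewrite inE /F => /existsP[i /existsP[w /eqP x_w]].
  case: pickP => [[i' w'] /= /eqP->|/(_ (i, w))]; last by rewrite x_w eqxx.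
  by exists i', w'; split=> //; apply: size_bseq.
have F_inj : {in T :&: ball v &, injective F}.
  move=> x y /setIP[_ /FP[i [w [szw -> ->]]]] /setIP[_ /FP[j [w' [szw' -> ->]]]].
  by move/eqP; rewrite (similar_near _ _ uv) // => /eqP.
have F_sub : F @: (T :&: ball v) \subset T :&: ball u.
  apply/subsetP=> _ /imsetP[x /setIP[Tx /FP[i [w [szw x_w ->]]]] ->].
  rewrite inE inE (similar_local_type i uv szw) -x_w; rewrite inE in Tx.
  rewrite Tx inE; apply/existsP; exists i; apply/nearP; by exists w.
have lt_vT : #|T :&: ball v| < #|T|.
  rewrite -(card_in_imset F_inj) (leq_ltn_trans (subset_leq_card F_sub)) //.
  apply: proper_card; rewrite properE subsetIl; apply/subsetPn; exists a.
    by rewrite inE.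
  by rewrite !inE eqxx; apply/existsPn.
have /subsetPn[b Tb] : ~~ (T \subset T :&: ball v).
  by apply: contraL lt_vT => /subset_leq_card; rewrite -leqNgt.
rewrite !inE in Tb *; rewrite Tb => /existsPn far_b.
by exists b; first exact/eqP.
Qed.

(** The back-and-forth step of an Ehrenfeucht-Fraisse argument: a near entry is copied by the same
    word, a far one is matched by [far_witness]. *)
Lemma similar_extend R n (u v : n.-tuple V) a :
  similar (3 * R) u v ->
  exists b, similar R (cons_tuple a u) (cons_tuple b v).
Proof.
move=> uv; have [/existsP[i /nearP[w szw ->]]|/existsPn far_a] :=
  boolP [exists i, near R (tnth u i) a].
  by exists (act w (tnth v i)); apply: similar_cons_near.
have [b eq_ba far_b] := far_witness uv far_a.
exists b; apply: similar_cons_far => //.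
by apply: similar_le uv; apply: leq_pmull.
Qed.

(** Atoms need radius 1, since adjacency is tested by words of length one; each quantifier costs one
    use of [similar_extend]. *)
Fixpoint radius n (phi : formula m n) : nat :=
  match phi with
  | FEq _ _ _ | FAdj _ _ _ | FCol _ _ _ => 1
  | FNot _ q => radius q
  | FAnd _ q r | FOr _ q r => maxn (radius q) (radius r)
  | FExists _ q | FForall _ q => 3 * radius q
  end.

Variable G : graph V.
Hypothesis G_p : forall u v, G u v = (u != v) && [exists i, p i u == v].

Lemma sat_similar n (phi : formula m n) (u v : n.-tuple V) :
  similar (radius phi) u v -> sat G col phi u = sat G col phi v.
Proof.
elim: phi u v => {n} /= [n i j|n i j|n k i|n q IHq|n q IHq r IHr|n q IHq r IHr
                        |n q IHq|n q IHq] u v uv.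
- by have [/(_ i j)] := uv [::] isT.
- rewrite !G_p; have [/(_ i j)/= -> _] := uv [::] isT.
  congr (_ && _); apply: eq_existsb => k.
  by rewrite eq_sym [RHS]eq_sym; have [/(_ j i)] := uv [:: k] isT.
- by have [_ /(_ i k)] := uv [::] isT.
- by rewrite (IHq u v uv).
- rewrite (IHq u v) 1?(IHr u v) //; apply: similar_le uv.
  + exact: leq_maxr.
  + exact: leq_maxl.
- rewrite (IHq u v) 1?(IHr u v) //; apply: similar_le uv.
  + exact: leq_maxr.
  + exact: leq_maxl.
- apply/existsP/existsP=> [] [a sat_a].
    by have [b /IHq eq_ab] := similar_extend a uv; exists b; rewrite -eq_ab.
  have [b /IHq eq_ab] := similar_extend a (similar_sym uv).
  by exists b; rewrite -eq_ab.
apply/forallP/forallP=> sat_all a.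
  have [b /IHq ->] := similar_extend a (similar_sym uv); exact: sat_all.
have [b /IHq ->] := similar_extend a uv; exact: sat_all.
Qed.

Lemma sat_far (phi : formula m 2) x y x' y' :
  let R := radius phi in
  ~~ near R x y -> ~~ near R x' y' ->
  local_type R x = local_type R x' -> local_type R y = local_type R y' ->
  sat G col phi [tuple x; y] = sat G col phi [tuple x'; y'].
Proof.
move=> R far far' eq_x eq_y; apply: sat_similar.
(* The pair is built from the empty tuple by two far extensions. *)
have nil_similar : similar R [tuple] [tuple] by move=> w _; split=> [] [].
have y_similar : similar R [tuple y] [tuple y'].
  by have := similar_cons_far nil_similar eq_y; apply=> [] [].
have := similar_cons_far y_similar eq_x; apply=> i; rewrite ord1 near_sym //.
Qed.

End Locality.

(** * Transductions of bounded degree as functions *)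

Section Cliques.
Variables (V : finType) (A : {set V}).

Definition clique_adj : rel V := fun x y => [&& x != y, x \in A & y \in A].

Lemma clique_sym : symmetric clique_adj.
Proof. by move=> x y; rewrite /clique_adj eq_sym [(x \in A) && _]andbC. Qed.

Lemma clique_irr : irreflexive clique_adj.
Proof. by move=> x; rewrite /clique_adj eqxx. Qed.

Definition clique_graph : graph V := Graph clique_sym clique_irr.
End Cliques.

Section Matchings.
Variables (V : finType) (p : V -> V).
Hypothesis pK : involutive p.

Definition matching_adj : rel V := fun x y => (x != y) && (p x == y).

Lemma matching_sym : symmetric matching_adj.
Proof. by move=> x y; rewrite /matching_adj eq_sym (can2_eq pK pK) [x == _]eq_sym. Qed.

Lemma matching_irr : irreflexive matching_adj.
Proof. by move=> x; rewrite /matching_adj eqxx. Qed.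

Definition matching_graph : graph V := Graph matching_sym matching_irr.
End Matchings.

(* On equivalence graphs this excludes two components with at least three
   vertices each, i.e. an induced 2K_3. *)
Definition two_triangle_free (V : finType) (G : graph V) : Prop :=
  forall a b c a' b' c', b != c -> b' != c' -> G a b -> G a c ->
    G a' b' -> G a' c' -> a != a' -> G a a'.

(** Covers both closure under isomorphism and heredity. *)
Lemma embedding_two_triangle_free (V W : finType) (G : graph V) (H : graph W) f :
  injective f -> (forall x y : V, H (f x) (f y) = G x y) ->
  equivalence_graph H /\ two_triangle_free H ->
  equivalence_graph G /\ two_triangle_free G.
Proof.
move=> f_inj fE [/equivalence_graphP trH freeH]; split.
  apply/equivalence_graphP=> x y z Gxy Gyz neq_xz.
  by rewrite -fE (trH _ (f y)) ?fE // (inj_eq f_inj).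
move=> a b c a' b' c' nbc nbc' Gab Gac Gab' Gac' naa'.
by rewrite -fE (freeH _ (f b) (f c) _ (f b') (f c')) ?fE ?(inj_eq f_inj).
Qed.

Lemma two_triangle_free_iso (V W : finType) (G : graph V) (H : graph W) :
  isomorphic G H -> equivalence_graph G /\ two_triangle_free G ->
  equivalence_graph H /\ two_triangle_free H.
Proof.
case=> f [g fK gK] fE; apply: (@embedding_two_triangle_free _ _ _ _ g).
  exact: can_inj gK.
by move=> x y; rewrite -fE !gK.
Qed.

Definition two_triangle_free_class : graph_class :=
  GraphClass two_triangle_free_iso.

Lemma two_triangle_free_proper :
  proper_subclass_of_equivalence_graphs two_triangle_free_class.
Proof.
split=> [V G A|V G []//|].
  by apply: (embedding_two_triangle_free (f := val)) => //; apply: val_inj.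
(* The missing equivalence graph is 2K_3. *)
pose e : rel (bool * 'I_3) := fun x y => (x != y) && (x.1 == y.1).
have e_sym : symmetric e by move=> x y; rewrite /e eq_sym [x.1 == _]eq_sym.
have e_irr : irreflexive e by move=> x; rewrite /e eqxx.
exists (bool * 'I_3)%type, (Graph e_sym e_irr); split.
  apply/equivalence_graphP=> x y z /andP[_ /eqP xy] /andP[_ /eqP yz] neq_xz.
  by rewrite /= /e neq_xz xy yz /=.
case=> _ /(_ (true, inord 0) (true, inord 1) (true, inord 2)
             (false, inord 0) (false, inord 1) (false, inord 2)).
by rewrite /= /e !xpair_eqE /= -!val_eqE /= !inordK //=; do !move/(_ isT).
Qed.

Lemma clique_two_triangle_free (V : finType) (A : {set V}) :
  two_triangle_free_class V (clique_graph A).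
Proof.
split.
  apply/equivalence_graphP=> x y z /and3P[_ xA _] /and3P[_ _ zA] neq_xz.
  exact/and3P.
move=> a b c a' b' c' _ _ /and3P[_ aA _] _ /and3P[_ aA' _] _ neq_aa'.
exact/and3P.
Qed.

Lemma matching_two_triangle_free (V : finType) (p : V -> V) (pK : involutive p) :
  two_triangle_free_class V (matching_graph pK).
Proof.
split.
  apply/equivalence_graphP=> x y z /andP[_ /eqP<-] /andP[_ /eqP<-].
  by rewrite pK eqxx.
move=> a b c a' b' c' neq_bc _ /andP[_ /eqP pab] /andP[_ /eqP pac].
by rewrite -pab pac eqxx in neq_bc.
Qed.

Lemma matchings_of_bounded_degree (V : finType) (e : rel V) (d : nat) :
  symmetric e -> (forall u, #|[set v | e u v]| <= d) ->
  exists F : 'I_(d * d).+1 * 'I_(d * d).+1 -> graph V,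
    (forall i, two_triangle_free_class V (F i)) /\
    (forall u v, u != v -> e u v = [exists i, F i u v]).
Proof.
move=> e_sym deg_e.
pose e' u v := (u != v) && e u v.
have e'_sym : symmetric e' by move=> u v; rewrite /e' eq_sym e_sym.
have e'_irr : irreflexive e' by move=> u; rewrite /e' eqxx.
have deg_e' u : #|[set v | e' u v]| <= d.
  apply: leq_trans (deg_e u); apply/subset_leq_card/subsetP=> v.
  by rewrite !inE => /andP[].
have [p [pK pE]] := @matching_decomposition V (Graph e'_sym e'_irr) d deg_e'.
exists (fun i => matching_graph (pK i)); split=> [i|u v neq_uv].
  exact: matching_two_triangle_free.
have := pE u v; rewrite /= /e' neq_uv /= => ->.
by apply: eq_existsb => i; rewrite /= /matching_adj neq_uv.
Qed.

(* The unordered pair of types of [x] and [y] is read off the cliques on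
   unions of two type classes: it is the smallest union containing both. *)
Lemma boolean_function_of_types (W : finType) (H : graph W) (T : finType)
    (t : W -> T) (g : rel T) (e : rel W) (d : nat) :
  symmetric e -> (forall u, #|[set v | e u v]| <= d) ->
  (forall x y, x != y -> ~~ e x y -> H x y = g (t x) (t y)) ->
  let I := ('I_(d * d).+1 * 'I_(d * d).+1)%type in
  exists F : 'I_#|{: I + I + T * T}| -> graph W,
    (forall i, two_triangle_free_class W (F i)) /\ boolean_function_of H F.
Proof.
move=> e_sym deg_e Hg I.
have sub_deg (r : rel W) : (forall x y, r x y -> e x y) ->
    forall u, #|[set v | r u v]| <= d.
  move=> re u; apply: leq_trans (deg_e u); apply/subset_leq_card/subsetP=> v.
  by rewrite !inE; apply: re.
(* Exceptional pairs are split into edges and non-edges of [H], so that the matchings reveal the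
   value of [H] on them. *)
have [||F1 [F1free F1E]] := @matchings_of_bounded_degree W
  (fun x y => e x y && H x y) d; first by move=> x y; rewrite e_sym adj_sym.
  by apply: sub_deg => x y /andP[].
have [||F0 [F0free F0E]] := @matchings_of_bounded_degree W
  (fun x y => e x y && ~~ H x y) d; first by move=> x y; rewrite e_sym adj_sym.
  by apply: sub_deg => x y /andP[].
pose C (st : T * T) := clique_graph [set x | (t x == st.1) || (t x == st.2)].
pose F (i : I + I + T * T) :=
  match i with inl (inl i) => F1 i | inl (inr i) => F0 i | inr st => C st end.
exists (fun i => F (enum_val i)); split=> [i|].
  case: (enum_val i) => [[i1|i0]|st]; [exact: F1free|exact: F0free|].
  exact: clique_two_triangle_free.
(* On the remaining pairs, look for [st] whose clique contains both vertices. If its two types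
   differ, neither type alone may contain both vertices, so these realise the two types in some
   order. *)
exists (fun b => let B i := tnth b (enum_rank i) in
  [exists i, B (inl (inl i))] || ~~ [exists i, B (inl (inr i))] &&
  [exists st : T * T, [&& B (inr st), g st.1 st.2 &
    (st.1 == st.2) || ~~ B (inr (st.1, st.1)) && ~~ B (inr (st.2, st.2))]]).
move=> x y neq_xy /=.
have BE i : tnth [tuple F (enum_val i) x y | i < #|{: I + I + T * T}|] (enum_rank i)
    = F i x y by rewrite tnth_mktuple enum_rankK.
have -> : [exists i, tnth [tuple F (enum_val i) x y | i < #|{: I + I + T * T}|]
    (enum_rank (inl (inl i)))] = e x y && H x y.
  by rewrite F1E //; apply: eq_existsb => i; rewrite BE.
have -> : [exists i, tnth [tuple F (enum_val i) x y | i < #|{: I + I + T * T}|]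
    (enum_rank (inl (inr i)))] = e x y && ~~ H x y.
  by rewrite F0E //; apply: eq_existsb => i; rewrite BE.
have [exy|far_xy] /= := boolP (e x y); first by case: (H x y).
apply/idP/existsP=> [Hxy|[[s s']]].
  exists (t x, t y); rewrite !BE /= /clique_adj !inE /= neq_xy !eqxx orbT /=.
  rewrite -Hg // Hxy /= !orbb (eq_sym (t y)).
  by case: (t x == t y).
rewrite !BE /= /clique_adj !inE /= neq_xy /= !orbb.
(* The order of the two types is not known; the symmetry of [H] settles the swapped case. *)
have Hyx : H x y = g (t y) (t x) by rewrite adj_sym Hg // 1?eq_sym // e_sym.
case/and3P=> /andP[tx ty] gss' min_ss'.
have [eq_ss'|neq_ss'] := eqVneq s s'.
  rewrite eq_ss' !orbb in tx ty gss'.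
  by rewrite Hg // (eqP tx) (eqP ty).
rewrite (negPf neq_ss') /= in min_ss'; case/andP: min_ss'.
case/orP: tx => /eqP tx; case/orP: ty => /eqP ty; rewrite tx ty ?eqxx //= => _ _.
  by rewrite Hg // tx ty.
by rewrite Hyx tx ty.
Qed.

Lemma copies_degree (V : finType) (G : graph V) (c d : nat) :
  (forall u, #|[set v | G u v]| <= d) ->
  forall u, #|[set v | copies G c u v]| <= d.
Proof.
move=> degG [i x]; apply: leq_trans (degG x).
have sub : [set v | copies G c (i, x) v] \subset pair i @: [set v | G x v].
  apply/subsetP=> -[j y]; rewrite inE => /andP[/= /eqP<- Gxy].
  by apply: imset_f; rewrite inE.
exact: leq_trans (subset_leq_card sub) (leq_imset_card _ _).
Qed.

Lemma structurally_bounded_degree_function (X : graph_class) :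
  structurally_bounded_degree X -> function_of X two_triangle_free_class.
Proof.
case=> Y [d degY] [c [m [phi trXY]]].
pose D := ('I_(d * d).+1 * 'I_(d * d).+1)%type.
pose R := radius phi.
pose T : finType := {ffun R.-bseq D -> bool * {ffun 'I_m -> bool}}.
pose N := #|{: R.-bseq D}|.
pose I := ('I_(N * N).+1 * 'I_(N * N).+1)%type.
(* This number depends only on [d], [m] and [phi], not on the graph. *)
exists #|{: I + I + T * T}| => W H /trXY[V [G [col [K [A [YG KE [f f_bij fE]]]]]]].
have [p [pK pE]] := matching_decomposition (copies_degree (c := c) (degY V G YG)).
have [h fK hK] := f_bij.
have h_inj : injective (val \o h).
  by apply: inj_comp val_inj (can_inj hK).
pose e x y := near p R (val (h x)) (val (h y)).
pose t x : T := local_type p col R (val (h x)).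
(* Two types are related when some far pair realising them is adjacent in [K]; by [sat_far], all
   such pairs then are. *)
pose g : rel T := fun s s' => [exists x, [exists y,
  [&& ~~ near p R x y, local_type p col R x == s, local_type p col R y == s'
    & K x y]]].
have e_sym : symmetric e by move=> x y; apply: near_sym.
have deg_e u : #|[set v | e u v]| <= N.
  apply: leq_trans (near_degree p R (val (h u))).
  rewrite -(card_imset _ h_inj); apply/subset_leq_card/subsetP=> _ /imsetP[v ev ->].
  by rewrite inE in ev; rewrite inE.
have Hg x y : x != y -> ~~ e x y -> H x y = g (t x) (t y).
  move=> _ far_xy; have -> : H x y = K (val (h x)) (val (h y)).
    by rewrite -{1}[x]hK -{1}[y]hK fE.
  apply/idP/existsP=> [Kxy|[x' /existsP[y' /and4P[far' /eqP tx /eqP ty]]]].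
    by exists (val (h x)); apply/existsP; exists (val (h y)); rewrite far_xy !eqxx.
  by rewrite !KE (sat_far pK pE far' far_xy).
have [F [Ffree HF]] := boolean_function_of_types e_sym deg_e Hg.
by exists #|{: I + I + T * T}|, F; split.
Qed.

(** * Functions as transductions of bounded degree *)

Lemma embedding_induced_iso (V W : finType) (G : graph V) (H : graph W) (f : V -> W) :
  injective f -> (forall x y, H (f x) (f y) = G x y) ->
  isomorphic (induced H (f @: setT)) G.
Proof.
move=> f_inj fE.
pose F x : {y | y \in f @: setT} := Sub (f x) (imset_f f (in_setT x)).
have [g FK gK] : bijective F.
  apply: inj_card_bij => [x y /(congr1 val)/f_inj //|].
  by rewrite card_sig card_imset // cardsT.
exists g; first by exists F.
by move=> x y; rewrite -fE -[in RHS](gK x) -[in RHS](gK y).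
Qed.

Section Classes.
Variables (V : finType) (H : graph V).

(** The closed neighbourhood, which in an equivalence graph is the connected component. *)
Definition eqclass (v : V) : {set V} := [set w | (w == v) || H v w].

Definition big_classes (n : nat) : {set {set V}} :=
  [set S in eqclass @: setT | n <= #|S|].

Lemma mem_eqclass v : v \in eqclass v.
Proof. by rewrite inE eqxx. Qed.

Lemma mem_big_classes n v : (eqclass v \in big_classes n) = (n <= #|eqclass v|).
Proof. by rewrite inE imset_f. Qed.

Hypothesis eqH : equivalence_graph H.

Lemma eq_eqclass u v : (eqclass u == eqclass v) = (u == v) || H u v.
Proof.
have /equivalence_graphP trH := eqH.
apply/eqP/idP=> [eq_uv|/predU1P[-> //|Huv]].
  by have := mem_eqclass v; rewrite -eq_uv inE eq_sym.
have sub x y : H x y -> eqclass x \subset eqclass y.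
  move=> Hxy; apply/subsetP=> z; rewrite !inE => /predU1P[->|Hxz].
    by rewrite adj_sym Hxy orbT.
  by case: eqVneq => //= neq_zy; apply: trH Hxz _; rewrite 1?adj_sym // eq_sym.
by apply/eqP; rewrite eqEsubset !sub // adj_sym.
Qed.

Lemma eqclass_mem u v : u \in eqclass v -> eqclass u = eqclass v.
Proof. by rewrite inE => uv; apply/eqP; rewrite eq_eqclass adj_sym. Qed.

End Classes.

Lemma empty_irr (V : finType) : irreflexive (fun _ _ : V => false).
Proof. by []. Qed.

Lemma empty_sym (V : finType) : symmetric (fun _ _ : V => false).
Proof. by []. Qed.

Definition empty_graph (V : finType) : graph V := Graph (@empty_sym V) (@empty_irr V).

(** [G0] has at most [#|V0|] components with at most [#|V0|] vertices each, so they fit into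
    distinct big classes of [H]. *)
Lemma embedding_of_big_classes (V0 V : finType) (G0 : graph V0) (H : graph V) :
  equivalence_graph G0 -> equivalence_graph H ->
  #|V0| <= #|big_classes H #|V0| | ->
  exists2 f : V0 -> V, injective f & forall x y, H (f x) (f y) = G0 x y.
Proof.
move=> eqG0 eqH many; set B := big_classes H #|V0| in many.
pose classes := eqclass G0 @: setT.
have memC x : eqclass G0 x \in enum classes by rewrite mem_enum imset_f.
pose j x := nth set0 (enum B) (index (eqclass G0 x) (enum classes)).
have lt_idx x : index (eqclass G0 x) (enum classes) < size (enum B).
  rewrite -cardE; apply: leq_trans many.
  have := memC x; rewrite -index_mem -cardE => /leq_trans; apply.
  by rewrite -cardsT leq_imset_card.
have jB x : j x \in B by rewrite -mem_enum mem_nth.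
have eq_j x y : (j x == j y) = (eqclass G0 x == eqclass G0 y).
  rewrite /j nth_uniq ?enum_uniq //; apply/eqP/eqP=> [|-> //].
  exact: (index_inj set0).
(* Send [x] to the element of its big class at position [enum_rank x]; as ranks are taken in all of
   [V0], injectivity is immediate. *)
have /fin_all_exists[f fP] : forall x, exists y,
    y \in j x /\ index y (enum (j x)) = enum_rank x.
  move=> x; have := jB x; rewrite inE => /andP[_ le_jx].
  pose i := widen_ord le_jx (enum_rank x).
  exists (enum_val i); split; first exact: enum_valP.
  rewrite (enum_val_nth (enum_val i)) index_uniq ?enum_uniq //.
  by rewrite -cardE; apply: (ltn_ord i).
have jE x : eqclass H (f x) = j x.
  have := jB x; rewrite inE => /andP[/imsetP[v _ jx] _].
  by have [] := fP x; rewrite jx => /(eqclass_mem eqH).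
have f_inj : injective f.
  move=> x y eq_f; have [_ rx] := fP x; have [_ ry] := fP y.
  apply: enum_rank_inj; apply: val_inj; rewrite /= -rx -ry.
  by rewrite -!jE eq_f.
exists f => // x y; have [->|neq_xy] := eqVneq x y; first by rewrite !adj_irr.
have := eq_j x y; rewrite -!jE !eq_eqclass // (inj_eq f_inj).
by rewrite (negPf neq_xy).
Qed.

(** The empty graph is included, whether or not it lies in [Y], because it later pads families of
    fewer than [k] graphs. *)
Lemma proper_few_big_classes (Y : graph_class) :
  proper_subclass_of_equivalence_graphs Y ->
  exists n, forall (V : finType) (H : graph V), Y V H \/ H = empty_graph V ->
    equivalence_graph H /\ #|big_classes H n| < n.
Proof.
(* Adding 2 makes singletons small, so that the empty graph has no big class; for members of [Y], a
   larger threshold only leaves fewer big classes. *)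
case=> herY eqY [V0 [G0 [eqG0 notY]]]; exists #|V0|.+2 => V H [YH|->]; last first.
  split; first by apply/equivalence_graphP.
  rewrite (_ : big_classes _ _ = set0) ?cards0 //.
  apply/setP=> S; rewrite !inE; apply/andP=> -[/imsetP[v _ ->]].
  rewrite (_ : eqclass _ v = [set v]) ?cards1 //.
  by apply/setP=> w; rewrite !inE orbF.
have eqH := eqY V H YH; split=> //.
have sub : big_classes H #|V0|.+2 \subset big_classes H #|V0|.
  apply/subsetP=> S; rewrite !inE => /andP[-> /=].
  by apply: leq_trans; rewrite -addn2 leq_addr.
apply: (leq_ltn_trans (subset_leq_card sub)); apply: contra_notT notY.
rewrite -leqNgt => /(leq_trans (leq_trans (leqnSn _) (leqnSn _))) many.
have [f f_inj fE] := embedding_of_big_classes eqG0 eqH many.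
exact: class_iso (embedding_induced_iso f_inj fE) (herY _ _ _ YH).
Qed.

Section BigFormulas.
Variables (m n : nat).

(** Truth values are not formulas, so the empty disjunction is a false equation, which takes a
    variable; hence [n.+1]. *)
Definition big_or (s : seq (formula m n.+1)) : formula m n.+1 :=
  foldr (@FOr m n.+1) (FNot (FEq m ord0 ord0)) s.

Definition big_and (s : seq (formula m n.+1)) : formula m n.+1 :=
  foldr (@FAnd m n.+1) (FEq m ord0 ord0) s.

Variables (V : finType) (G : graph V) (col : 'I_m -> {set V}).

Lemma sat_big_or s env :
  sat G col (big_or s) env = has (fun phi => sat G col phi env) s.
Proof. by elim: s => [|phi s /= -> //]; rewrite /= eqxx. Qed.

Lemma sat_big_and s env :
  sat G col (big_and s) env = all (fun phi => sat G col phi env) s.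
Proof. by elim: s => [|phi s /= -> //]; rewrite /= eqxx. Qed.

End BigFormulas.

(* Vertices of the gadget: those of V, and one vertex (i, S) for every possible
   class S of the i-th equivalence graph, joined to its members if S is small. *)
Section Gadget.
Variables (V : finType) (k N : nat) (H : 'I_k -> graph V).

Definition gadget_vertex : finType := (V + 'I_k * {set V})%type.

Definition gadget_adj : rel gadget_vertex := fun u v =>
  match u, v with
  | inl x, inr iS | inr iS, inl x => (iS.2 == eqclass (H iS.1) x) && (#|iS.2| < N)
  | _, _ => false
  end.

Lemma gadget_sym : symmetric gadget_adj.
Proof. by move=> [x|iS] [y|jS]. Qed.

Lemma gadget_irr : irreflexive gadget_adj.
Proof. by case. Qed.

Definition gadget : graph gadget_vertex := Graph gadget_sym gadget_irr.

(** A vertex of [V] has at most one neighbour for each [i]; a small class has fewer than [N] members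
    and a big one is isolated. *)
Lemma gadget_degree u : #|[set v | gadget u v]| <= k + N.
Proof.
case: u => [x|[i S]].
  pose F i : gadget_vertex := inr (i, eqclass (H i) x).
  have sub : [set v | gadget (inl x) v] \subset F @: setT.
    apply/subsetP=> -[y|[i S]]; rewrite inE //= => /andP[/eqP-> _].
    exact: (imset_f F).
  apply: leq_trans (subset_leq_card sub) _.
  by rewrite (leq_trans (leq_imset_card _ _)) // cardsT card_ord leq_addr.
have [ltSN|leNS] := ltnP #|S| N.
  have sub : [set v | gadget (inr (i, S)) v] \subset [set inl x | x in S].
    apply/subsetP=> -[y|jT]; rewrite inE //= => /andP[/eqP-> _].
    by apply: imset_f; apply: mem_eqclass.
  apply: leq_trans (subset_leq_card sub) _.
  by rewrite (leq_trans (leq_imset_card _ _)) // (leq_trans (ltnW ltSN)) ?leq_addl.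
rewrite (_ : [set v | _] = set0) ?cards0 //.
by apply/setP=> -[y|jT]; rewrite !inE //= ltnNge leNS andbF.
Qed.

(* The colours record the truth table of f, the big classes of each H i, and
   the index i of each class vertex (i, S). *)
Definition color_index : finType :=
  (k.-tuple bool + 'I_k * 'I_N + 'I_k)%type.

Variable f : k.-tuple bool -> bool.

Definition gadget_color (c : color_index) : {set 'I_1 * gadget_vertex} :=
  match c with
  | inl (inl b) => if f b then setT else set0
  | inl (inr it) => [set u : 'I_1 * gadget_vertex | if u.2 is inl x then
      (eqclass (H it.1) x \in big_classes (H it.1) N) &&
      (index (eqclass (H it.1) x) (enum (big_classes (H it.1) N)) == it.2)
      else false]
  | inr i => [set u : 'I_1 * gadget_vertex | if u.2 is inr iS then iS.1 == i else false]
  end.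

Definition gadget_col (j : 'I_#|color_index|) := gadget_color (enum_val j).

Let sat_gadget n (phi : formula #|color_index| n) :=
  sat (copies gadget 1) gadget_col phi.

Definition color_formula n (c : color_index) (x : 'I_n) : formula #|color_index| n :=
  FCol (enum_rank c) x.

(** The first disjunct finds a shared small class as a common neighbour of colour [i], index 0 being
    the bound vertex; the second finds a shared big class as a common colour. *)
Definition class_formula (i : 'I_k) : formula #|color_index| 2 :=
  FOr (FExists (FAnd (color_formula (inr i) (@Ordinal 3 0 isT))
         (FAnd (FAdj _ (@Ordinal 3 0 isT) (@Ordinal 3 1 isT))
               (FAdj _ (@Ordinal 3 0 isT) (@Ordinal 3 2 isT)))))
      (big_or [seq FAnd (color_formula (inl (inr (i, t))) (@Ordinal 2 0 isT))
                        (color_formula (inl (inr (i, t))) (@Ordinal 2 1 isT))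
              | t <- enum 'I_N]).

(** A transduction has one formula while [f] varies with the graph, so [f] is read from the colours:
    colour [b] is everything or nothing according to [f b]. *)
Definition gadget_formula : formula #|color_index| 2 :=
  FAnd (FNot (FEq _ (@Ordinal 2 0 isT) (@Ordinal 2 1 isT)))
    (big_or [seq FAnd (color_formula (inl (inl b)) (@Ordinal 2 0 isT))
                   (big_and [seq if tnth b i then class_formula i
                                 else FNot (class_formula i) | i <- enum 'I_k])
            | b <- enum {: k.-tuple bool}]).

Definition same_class (i : 'I_k) (u v : 'I_1 * gadget_vertex) : bool :=
  [exists z, [&& z \in gadget_color (inr i), copies gadget 1 z u & copies gadget 1 z v]]
  || [exists t, (u \in gadget_color (inl (inr (i, t)))) &&
                (v \in gadget_color (inl (inr (i, t))))].

Lemma same_class_sym i u v : same_class i u v = same_class i v u.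
Proof.
by congr (_ || _); apply: eq_existsb => z; rewrite [_ && (_ v)]andbC.
Qed.

Lemma sat_class_formula i u v :
  sat_gadget (class_formula i) [tuple u; v] = same_class i u v.
Proof.
rewrite /sat_gadget /= sat_big_or has_map; congr (_ || _).
  by apply: eq_existsb => z; rewrite /gadget_col enum_rankK.
apply/hasP/existsP=> [[t _]|[t uv]].
  by rewrite /= /gadget_col enum_rankK; exists t.
by exists t; rewrite ?mem_enum //= /gadget_col enum_rankK.
Qed.

Lemma sat_gadget_formula u v :
  sat_gadget gadget_formula [tuple u; v] =
  (u != v) && f [tuple same_class i u v | i < k].
Proof.
rewrite /sat_gadget /= sat_big_or has_map; congr (_ && _).
(* Only the actual vector of truth values satisfies the conjunction for [b]. *)
have satE b : all (fun phi => sat_gadget phi [tuple u; v])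
    [seq if tnth b i then class_formula i else FNot (class_formula i)
    | i <- enum 'I_k] = (b == [tuple same_class i u v | i < k]).
  rewrite all_map; apply/allP/eqP=> [eq_b|-> i _ /=].
    apply: eq_from_tnth => i; rewrite tnth_mktuple.
    have := eq_b i (mem_enum _ _); rewrite /= -sat_class_formula.
    by case: (tnth b i) => /= [-> //|]; rewrite /sat_gadget /= => /negPf.
  rewrite tnth_mktuple -sat_class_formula.
  by case: ifP => // /negbT.
apply/hasP/idP=> [[b _ /=]|fb].
  rewrite sat_big_and => /andP[+ sat_b]; move: sat_b.
  rewrite satE => /eqP <-; rewrite /gadget_col enum_rankK /=.
  by case: ifP => //; rewrite inE.
exists [tuple same_class i u v | i < k]; first by rewrite mem_enum.
rewrite /= sat_big_and satE; apply/andP; split=> //.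
by rewrite /gadget_col enum_rankK /= fb inE.
Qed.

Definition gadget_target_adj : rel ('I_1 * gadget_vertex) :=
  fun u v => sat_gadget gadget_formula [tuple u; v].

Lemma gadget_target_sym : symmetric gadget_target_adj.
Proof.
move=> u v; rewrite /gadget_target_adj !sat_gadget_formula eq_sym.
congr (_ && f _); apply: eq_from_tnth => i; rewrite !tnth_mktuple.
exact: same_class_sym.
Qed.

Lemma gadget_target_irr : irreflexive gadget_target_adj.
Proof. by move=> u; rewrite /gadget_target_adj sat_gadget_formula eqxx. Qed.

Definition gadget_target : graph ('I_1 * gadget_vertex)%type :=
  Graph gadget_target_sym gadget_target_irr.

Hypothesis eqH : forall i, equivalence_graph (H i).
Hypothesis few_big : forall i, #|big_classes (H i) N| < N.

Lemma same_class_inl i x y : x != y ->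
  same_class i (ord0, inl x) (ord0, inl y) = H i x y.
Proof.
move=> neq_xy; have eq_cls := eq_eqclass (@eqH i) x y.
rewrite (negPf neq_xy) /= in eq_cls; rewrite -eq_cls.
apply/orP/eqP=> [[/existsP[[j [z|[i' S]]]]|/existsP[t]]|eq_xy].
- by rewrite inE.
- rewrite inE /= /copies_adj /= => /and3P[/eqP->].
  by move=> /and3P[_ /eqP<- _] /and3P[_ /eqP<-].
- rewrite !inE /= => /andP[/andP[xB /eqP x_t] /andP[yB /eqP y_t]].
  by apply: (index_inj set0 _ _ (etrans x_t (esym y_t))); rewrite mem_enum.
have [small|big] := ltnP #|eqclass (H i) x| N.
  left; apply/existsP; exists (ord0, inr (i, eqclass (H i) x)).
  by rewrite inE /= /copies_adj /= small -eq_xy !eqxx.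
right; have xB : eqclass (H i) x \in big_classes (H i) N by rewrite mem_big_classes.
(* There are fewer than [N] big classes, so the index of this one is among the [N] available
   colours. *)
have lt_t : index (eqclass (H i) x) (enum (big_classes (H i) N)) < N.
  by rewrite (leq_trans _ (few_big i)) // ltnS cardE index_size.
apply/existsP; exists (Ordinal lt_t).
by apply/andP; split; rewrite inE /= -?eq_xy xB eqxx.
Qed.

End Gadget.

Lemma function_structurally_bounded_degree (X Y : graph_class) :
  proper_subclass_of_equivalence_graphs Y -> function_of X Y ->
  structurally_bounded_degree X.
Proof.
move=> /proper_few_big_classes[N YP] [k kXY].
have deg_iso (V W : finType) (G : graph V) (H : graph W) : isomorphic G H ->
    (forall u, #|[set v | G u v]| <= k + N) -> forall u, #|[set v | H u v]| <= k + N.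
  case=> f f_bij fE degG; have [g fK gK] := f_bij => u.
  apply: leq_trans (degG (g u)); rewrite -(card_imset _ (can_inj gK)).
  apply/subset_leq_card/subsetP=> _ /imsetP[v Huv ->].
  by rewrite !inE in Huv *; rewrite -fE !gK.
exists (GraphClass deg_iso); first by exists (k + N).
exists 1, #|color_index k N|, (gadget_formula k N) => W G /kXY[j [H [le_jk YH [f fE]]]].
(* Pad to exactly [k] graphs with edgeless ones; [f'] ignores the padding. *)
pose H' (i : 'I_k) := if insub (val i) is Some i' then H i' else empty_graph W.
have H'P i : equivalence_graph (H' i) /\ #|big_classes (H' i) N| < N.
  by apply: YP; rewrite /H'; case: insub => [i'|]; [left|right].
have eqH' i := (H'P i).1; have fewH' i := (H'P i).2.
pose f' (b : k.-tuple bool) := f [tuple tnth b (widen_ord le_jk i) | i < j].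
pose K := gadget_target N H' f'.
pose emb (x : W) : 'I_1 * gadget_vertex W k := (ord0, inl x).
have emb_inj : injective emb by move=> x y [].
exists (gadget_vertex W k), (gadget N H'), (gadget_col H' f').
exists K, (emb @: setT); split=> //; first exact: gadget_degree.
apply: embedding_induced_iso => // x y.
rewrite /= /gadget_target_adj sat_gadget_formula (inj_eq emb_inj).
have [->|neq_xy] /= := eqVneq x y; first by rewrite adj_irr.
rewrite fE //; congr f; apply: eq_from_tnth => i; rewrite !tnth_mktuple.
by rewrite same_class_inl // /H' /= valK.
Qed.

Theorem theorem4p22 (X : graph_class) :
  structurally_bounded_degree X <->
  exists Y : graph_class,
    proper_subclass_of_equivalence_graphs Y /\ function_of X Y.
Proof.
split=> [sbdX|[Y [properY funXY]]].
  exists two_triangle_free_class; split; first exact: two_triangle_free_proper.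
  exact: structurally_bounded_degree_function.
exact: function_structurally_bounded_degree properY funXY.
Qed.
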